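(* Let $X$ be a homogeneous compactum. Then $dis(X) \geq \Delta(X)$.
   Context: A compactum is a compact Hausdorff space. A space $X$ is homogeneous if for all $x,y\in X$ there is a homeomorphism of $X$ onto itself taking $x$ to $y$. $dis(X)$ denotes the least number of discrete sets required to cover $X$ (a subset of $X$ is discrete if its subspace topology is discrete; it need not be closed in $X$). $\Delta(X)$ denotes the least cardinality of a nonempty open subset of $X$ (for nonempty $X$). *)

(* Defs.v *)
From mathcomp Require Import all_boot all_order all_algebra.
From mathcomp Require Import all_classical all_reals all_analysis.

Set Implicit Arguments.
Unset Strict Implicit.
Unset Printing Implicit Defensive.

Local Open Scope classical_set_scope.
Local Open Scope card_scope.

(* A cardinal number is represented by a set having that cardinality, and
   cardinals are compared by [#<=].  [least_card F] is a member of [F] of least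
   cardinality; the value [set0] for empty [F] is junk. *)
Definition least_card (T : Type) (F : set (set T)) : set T :=
  xget set0 [set A | F A /\ forall B, F B -> A #<= B].

Lemma ex_least_card (T : Type) (F : set (set T)) :
  F !=set0 -> exists A, F A /\ forall B, F B -> A #<= B.
Proof.
move=> [A0 FA0]; have [F0|nF0] := pselect (F set0).
  by exists set0; split=> // B _; exact: card_ge0.
have [t0 _] : A0 !=set0 by apply/set0P; apply/eqP => A00; rewrite A00 in FA0.
(* a maximal family of choice functions on [F] that pairwise differ at every
   member of [F]; it injects into each member and is onto some member *)
pose P (S : set (set T -> T)) := (forall g A, S g -> F A -> A (g A)) /\
  (forall g h A, S g -> S h -> F A -> g A = h A -> g = h).
have [S [[SF Sinj] Smax]] : exists S, P S /\ forall S', S `<` S' -> ~ P S'.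
  apply: Zorn_bigcup => G GP Gtot; split.
    by move=> g A [S GS Sg] FA; exact: ((GP _ GS).1 g A Sg FA).
  move=> g h A [S GS Sg] [S' GS' S'h] FA.
  have [SS'|S'S] := Gtot _ _ GS GS'.
    by have [_ +] := GP _ GS'; apply=> //; exact: SS'.
  by have [_ +] := GP _ GS; apply=> //; exact: S'S.
have [A [FA AS]] : exists A, F A /\ A `<=` (fun g => g A) @` S.
  apply: contrapT => nA.
  have /choice[f fP] : forall A, exists t, F A -> A t /\ ~ ((fun g => g A) @` S) t.
    move=> A; have [FA|nFA] := pselect (F A); last by exists t0.
    apply: contrapT => nt; apply: nA; exists A; split=> // a Aa.
    by apply: contrapT => na; apply: nt; exists a.
  apply: (Smax (S `|` [set f])).
    split; first by move=> g Sg; left.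
    move=> /(_ f (or_intror erefl)) Sf.
    by apply: (fP _ FA0).2; exists f.
  split.
    by move=> g A [Sg|->] FA; [exact: (SF _ _ Sg FA)|exact: (fP _ FA).1].
  move=> g h A [Sg|->] [Sh|->] FA //; first exact: Sinj FA.
    by move=> E; case: (fP _ FA).2; exists g.
  by move=> E; case: (fP _ FA).2; exists h.
exists A; split=> // B FB.
apply: card_le_trans (subset_card_le AS) _.
apply: card_le_trans (card_image_le _ _) _.
have SB : (fun g : set T -> T => g B) @` S #= S.
  apply: inj_card_eq => g h /set_mem Sg /set_mem Sh; exact: Sinj FB.
by rewrite -(card_le_eql SB); apply: subset_card_le => _ [g Sg <-]; exact: (SF _ _ Sg FB).
Qed.

Lemma least_cardP (T : Type) (F : set (set T)) : F !=set0 ->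
  F (least_card F) /\ forall B, F B -> least_card F #<= B.
Proof. by move=> /ex_least_card; exact: xgetPex. Qed.

Definition homeomorphism (X Y : topologicalType) (f : X -> Y) : Prop :=
  continuous f /\
  exists g : Y -> X, [/\ continuous g, cancel f g & cancel g f].

Definition homogeneous (X : topologicalType) : Prop :=
  forall x y : X, exists f : X -> X, homeomorphism f /\ f x = y.

(* [set_type D] carries the subspace topology. *)
Definition discrete_set (X : topologicalType) (D : set X) : Prop :=
  forall B : set (set_type D), open B.

Definition discrete_cover (X : topologicalType) (C : set (set X)) : Prop :=
  (forall D, C D -> discrete_set D) /\ \bigcup_(D in C) D = [set: X].

Definition dis (X : topologicalType) : set (set X) :=
  least_card (@discrete_cover X).

Arguments dis : clear implicits.

(* [Delta X] is meaningful for nonempty [X]; it is [set0] for empty [X]. *)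
Definition Delta (X : topologicalType) : set X :=
  least_card [set U : set X | open U /\ U !=set0].

Arguments Delta : clear implicits.

Lemma discrete_setP (X : topologicalType) (D : set X) :
  discrete_set D <-> D `<=` isolated D.
Proof.
split=> [dD x Dx|dD B].
  have [U oU UE] := dD [set y | set_val y = x].
  split; [exact: mem_set|exists U].
    apply: open_nbhs_nbhs; split=> //.
    have : [set y : D | set_val y = x] (SigSub (mem_set Dx)) by [].
    by rewrite -UE.
  apply/seteqP; split=> [y [Uy Dy]|_ ->] //=; last first.
    split=> //.
    have : [set y : D | set_val y = x] (SigSub (mem_set Dx)) by [].
    by rewrite -UE.
  have : (set_val @^-1` U) (SigSub (mem_set Dy)) by [].
  by rewrite UE.
rewrite openE => y By.
have [_ [U Uy UD]] := dD _ (set_valP y).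
have cy : continuous (set_val : D -> X) by exact: initial_continuous.
have yU := cy y U Uy.
apply: (@filterS _ (nbhs y) _ (set_val @^-1` U)) => [z Uz|//].
have : (D `&` U) (set_val z) by split=> //; exact: set_valP.
by rewrite setIC UD => /val_inj ->.
Qed.

Lemma discrete_cover_set1 (X : topologicalType) :
  discrete_cover (range (@set1 X)).
Proof.
split=> [_ [x _ <-]|]; last first.
  by apply/seteqP; split=> // x _; exists [set x]; [exists x|].
apply/discrete_setP => y /= ->; split; [exact: mem_set|exists setT]; first exact: filterT.
by rewrite setTI.
Qed.

Lemma disP (X : topologicalType) : discrete_cover (dis X) /\
  forall C : set (set X), discrete_cover C -> dis X #<= C.
Proof.
by apply: least_cardP; exists (range (@set1 X)); exact: discrete_cover_set1.
Qed.

Lemma DeltaP (X : topologicalType) : [set: X] !=set0 ->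
  [/\ open (Delta X), Delta X !=set0 &
      forall U : set X, open U -> U !=set0 -> Delta X #<= U].
Proof.
move=> X0; have [|[oD D0] Dmin] :=
  @least_cardP X [set U : set X | open U /\ U !=set0].
  by exists setT; split=> //; exact: openT.
by split=> // U oU U0; exact: Dmin.
Qed.

(* Main.v *)
Require Import Defs.
From mathcomp Require Import all_boot all_order all_algebra.
From mathcomp Require Import all_classical all_reals all_analysis.

(** Let [C] be a cover of [X] by discrete sets.

    Suppose [C] is infinite.  It is enough to show that [X] has no more points
    than [C] has members, and this takes two steps.

    - Some point of [X] is the intersection of at most [#|C|] open sets
      ([discrete_cover_pseudopoint]).  This is a Baire category argument: a
      discrete set is nowhere dense in any set without isolated points, so one
      can shrink [X] to smaller and smaller closed sets, each cut out by few
      open sets, that miss the members of [C] one after the other.  Since [C]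
      covers [X], the process must stop, and it stops only at a set with a
      relatively isolated point.  By homogeneity every point of [X] is then
      such an intersection.

    - A compactum covered by infinitely many discrete sets [D k], [k : K], in
      which every point [x] is the intersection of open sets [U x j], with at
      most [#|K|] indices [j], has at most [#|K|] points
      ([card_le_discrete_cover]).  A discrete [D k] is locally finite at each
      of its points, so it accumulates only on a closed set [A k] disjoint
      from it.  Close off the family of the [A k] under finite intersections
      and under the following step: if a member [F] of the family misses
      [A k], then [F `&` D k] is finite by compactness; add the complements of
      the sets [U y j] for [y] in [F `&` D k].  The members of this family are
      named by finite terms over [K], so there are only [#|K|] of them and
      only [#|K|] points [y] arise.  Every [x] in [X] arises
      ([point_named_by_term]): otherwise intersect all members of the family
      that contain [x], and intersect further with as many [A k] as possible
      while the result [H] stays nonempty.  A point [y] of [H] lies in some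
      [D k]; then [H] misses [A k] by maximality, so by compactness some
      member [F] of the family with [H `<=` F] misses [A k], and [y] is one of
      the points of [F `&` D k].  As [y] differs from [x], one of the sets
      [U y j] omits [x]; its complement is a member containing [x], hence
      contains [H], although [y] is in [H] and not in it.

    If [C] is finite, the Baire argument takes finitely many steps and produces
    an isolated point, that is, an open set of cardinality [1]. *)

Set Implicit Arguments.
Unset Strict Implicit.
Unset Printing Implicit Defensive.

Local Open Scope classical_set_scope.
Local Open Scope card_scope.

(** * Zorn's lemma and cardinals *)

(** Asking the chains to be nonempty lets the starting point [S0] take care of
    the empty chain. *)
Lemma Zorn_above (T : Type) (P : set (set T)) (S0 : set T) :
  P S0 ->
  (forall F : set (set T), F !=set0 -> F `<=` P -> total_on F subset ->
     P (\bigcup_(S in F) S)) ->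
  exists S, [/\ S0 `<=` S, P S & forall S', S `<=` S' -> P S' -> S' `<=` S].
Proof.
move=> PS0 Pchain.
have [S [PS Smax]] : exists S, P (S0 `|` S) /\
    forall S', S `<` S' -> ~ P (S0 `|` S').
  apply: (@Zorn_bigcup _ [set S | P (S0 `|` S)]) => F FP Ftot /=.
  have [->|/set0P[S1 FS1]] := eqVneq F set0.
    by rewrite bigcup_set0 setU0.
  have -> : S0 `|` \bigcup_(S in F) S =
      \bigcup_(S in (fun S => S0 `|` S) @` F) S.
    apply/seteqP; split=> [x [S0x|[S FS Sx]]|x [_ [S FS <-] [S0x|Sx]]].
    - by exists (S0 `|` S1); [exists S1|left].
    - by exists (S0 `|` S); [exists S|right].
    - by left.
    - by right; exists S.
  apply: Pchain; first by exists (S0 `|` S1), S1.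
    by move=> _ [S FS <-]; exact: FP.
  move=> _ _ [S FS <-] [S' FS' <-].
  by have [SS'|S'S] := Ftot _ _ FS FS'; [left|right]; exact: setUS.
exists (S0 `|` S); split=> // S' SS' PS'.
apply: contrapT => nS'S; apply: (Smax S'); last first.
  by rewrite setUidr // => x S0x; apply: SS'; left.
split=> [x Sx|S'S]; first by apply: SS'; right.
by apply: nS'S => x /S'S; right.
Qed.

Lemma card_le_inj (T U : Type) (A : set T) (B : set U) (b : U) :
  A #<= B -> exists2 f : T -> U, (forall a, A a -> B (f a)) &
    forall a a', A a -> A a' -> f a = f a' -> a = a'.
Proof.
elim/Ppointed: U => U in B b *; first by have := no b.
move=> /pcard_leP /injfunPex [f fAB finj]; exists f => // a a' Aa Aa'.
by apply: finj; exact: mem_set.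
Qed.

Lemma inj_le_card (T U : Type) (A : set T) (B : set U) (f : T -> U) :
  (forall a, A a -> B (f a)) ->
  (forall a a', A a -> A a' -> f a = f a' -> a = a') -> A #<= B.
Proof.
move=> fAB finj; have [g] : $|{injfun A >-> B}|.
  apply/injfunPex; exists f => // a a' /set_mem Aa /set_mem Aa'.
  exact: finj.
exact: inj_card_le.
Qed.

Lemma card_le_total_same (T : Type) (A B : set T) : A #<= B \/ B #<= A.
Proof.
have [|D [DAB Dmin]] := @ex_least_card T [set A; B]; first by exists A; left.
by case: DAB => <-; [left|right]; apply: Dmin; [right|left].
Qed.

(** * Squares of infinite types *)

Section Squares.
Variable K : Type.
Implicit Types (G : set (K * K * K)) (A : set K) (g : K -> K -> K).

Definition dom G : set K := [set a | exists c, G (a, a, c)].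

(** The graphs of the injections [A * A -> A] for varying [A = dom G]: as graphs
    they are ordered by inclusion, as Zorn's lemma needs. *)
Definition square_graph G : Prop :=
  [/\ forall a b c, G (a, b, c) -> [/\ dom G a, dom G b & dom G c],
      forall a b, dom G a -> dom G b -> exists c, G (a, b, c),
      forall a b c c', G (a, b, c) -> G (a, b, c') -> c = c' &
      forall a b a' b' c, G (a, b, c) -> G (a', b', c) -> a = a' /\ b = b'].

Definition square_inj A g : Prop :=
  (forall a b, A a -> A b -> A (g a b)) /\
  forall a b a' b', A a -> A b -> A a' -> A b' ->
    g a b = g a' b' -> a = a' /\ b = b'.

Definition graph_on A g : set (K * K * K) :=
  [set t | [/\ A t.1.1, A t.1.2 & t.2 = g t.1.1 t.1.2]].

Lemma dom_graph_on A g : dom (graph_on A g) = A.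
Proof.
apply/seteqP; split=> [a [c [/= Aa _ _]] //|a Aa].
by exists (g a a).
Qed.

Lemma square_graph_on A g : square_inj A g -> square_graph (graph_on A g).
Proof.
move=> [gA ginj]; split; rewrite ?dom_graph_on.
- by move=> a b c [/= Aa Ab ->]; split=> //; exact: gA.
- by move=> a b Aa Ab; exists (g a b).
- by move=> a b c c' [/= _ _ ->] [/= _ _ ->].
- by move=> a b a' b' c [/= Aa Ab ->] [/= Aa' Ab'] /ginj; apply.
Qed.

Lemma square_graphE G : square_graph G ->
  exists2 g, square_inj (dom G) g & G = graph_on (dom G) g.
Proof.
move=> [Gd Gt Gf Gi].
have /choice[g gP] : forall p : K * K, exists c,
    dom G p.1 -> dom G p.2 -> G (p.1, p.2, c).
  move=> [a b]; have [[da db]|nd] := pselect (dom G a /\ dom G b).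
    by have [c Gc] := Gt a b da db; exists c.
  by exists a => da db; case: nd.
exists (fun a b => g (a, b)).
  split=> [a b da db|a b a' b' da db da' db' E].
    by have [] := Gd _ _ _ (gP (a, b) da db).
  apply: (Gi _ _ _ _ (g (a, b))); first exact: gP (a, b) da db.
  by rewrite E; exact: gP (a', b') da' db'.
apply/seteqP; split=> [[[a b] c] Gabc|[[a b] c] [/= da db ->]].
  have [da db _] := Gd _ _ _ Gabc; split=> //=.
  exact: Gf Gabc (gP (a, b) da db).
exact: gP (a, b) da db.
Qed.

Lemma square_graph_chain (F : set (set (K * K * K))) :
  F `<=` square_graph -> total_on F subset ->
  square_graph (\bigcup_(G in F) G).
Proof.
move=> FP Ftot.
have two s t : (\bigcup_(G in F) G) s -> (\bigcup_(G in F) G) t ->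
    exists G, [/\ F G, G s & G t].
  move=> [G FG Gs] [G' FG' G't]; have [sub|sub] := Ftot _ _ FG FG'.
    by exists G'; split=> //; exact: sub.
  by exists G; split=> //; exact: sub.
have domS G : F G -> dom G `<=` dom (\bigcup_(G in F) G).
  by move=> FG a [c Gc]; exists c, G.
split.
- move=> a b c [G FG Gabc]; have [Gd _ _ _] := FP _ FG.
  by have [da db dc] := Gd _ _ _ Gabc; split; exact: domS FG _ _.
- move=> a b [c Gc] [c' Gc']; have [G [FG Ga Gb]] := two _ _ Gc Gc'.
  have [_ Gt _ _] := FP _ FG.
  by have [|//|e Ge] := Gt a b; [exists c|exists c'|exists e, G].
- move=> a b c c' h h'; have [G [FG Gs Gt]] := two _ _ h h'.
  by have [_ _ Gf _] := FP _ FG; exact: Gf Gs Gt.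
- move=> a b a' b' c h h'; have [G [FG Gs Gt]] := two _ _ h h'.
  by have [_ _ _ Gi] := FP _ FG; exact: Gi Gs Gt.
Qed.

(** A copy [h @` A] of [A] outside [A] gives room for the new pairs: a pair of
    points of [A `|` h @` A] not both in [A] is determined by the points of [A]
    that they come from together with two booleans, and this information is
    stored in [h @` A]. *)
Lemma square_inj_extend A g (h : K -> K) (tag : bool -> bool -> K) :
  square_inj A g ->
  (forall a, A a -> ~ A (h a)) ->
  (forall a a', A a -> A a' -> h a = h a' -> a = a') ->
  (forall i j, A (tag i j)) ->
  (forall i j i' j', tag i j = tag i' j' -> i = i' /\ j = j') ->
  exists2 g', square_inj (A `|` h @` A) g' &
    forall a b, A a -> A b -> g' a b = g a b.
Proof.
move=> [gA ginj] hnA hinj tagA taginj; pose B := A `|` h @` A.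
have /choice[r rP] : forall u, exists a, B u ->
    A a /\ u = if u \in A then a else h a.
  move=> u; have [[Au|[a Aa <-]]|nBu] := pselect (B u).
  - by exists u => _; rewrite mem_set.
  - by exists a => _; rewrite memNset //; exact: hnA.
  - by exists u.
have rinj u v : B u -> B v -> (u \in A) = (v \in A) -> r u = r v -> u = v.
  move=> /rP[_ uE] /rP[_ vE] E E'.
  by rewrite uE vE E E'.
pose code u v := g (tag (u \in A) (v \in A)) (g (r u) (r v)).
have codeA u v : B u -> B v -> A (code u v).
  by move=> /rP[ru _] /rP[rv _]; apply: (gA) => //; exact: gA.
pose g' u v := if (u \in A) && (v \in A) then g u v else h (code u v).
exists g'; last by move=> a b Aa Ab; rewrite /g' !mem_set.
split=> [u v Bu Bv|u v u' v' Bu Bv Bu' Bv'].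
  rewrite /g'; case: ifPn => [/andP[/set_mem Au /set_mem Av]|_].
    by left; exact: gA.
  by right; exists (code u v) => //; exact: codeA.
rewrite /g'; case: ifPn => [/andP[/set_mem Au /set_mem Av]|_];
  case: ifPn => [/andP[/set_mem Au' /set_mem Av']|_].
- exact: ginj.
- by move=> E; case: (hnA (code u' v')); [exact: codeA|rewrite -E; exact: gA].
- by move=> E; case: (hnA (code u v)); [exact: codeA|rewrite E; exact: gA].
have [[ru _] [rv _]] := (rP _ Bu, rP _ Bv).
have [[ru' _] [rv' _]] := (rP _ Bu', rP _ Bv').
move=> /hinj E; have /ginj[] := E (codeA _ _ Bu Bv) (codeA _ _ Bu' Bv').
- exact: tagA.
- exact: gA.
- exact: tagA.
- exact: gA.
by move=> /taginj[tu tv] /ginj[] // Eu Ev; split; exact: rinj.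
Qed.

(** Let [A] be the domain of a maximal injection [A * A -> A] with [A] infinite.
    If the complement of [A] were large enough to contain a copy of [A], the
    injection could be extended; so the complement embeds in [A], and then [K]
    embeds in two disjoint copies of [A] inside [A]. *)
Lemma infinite_pairing : infinite_set [set: K] ->
  exists p : K -> K -> K, forall a b c d, p a b = p c d -> a = c /\ b = d.
Proof.
move=> Kinf; have [k0 _] := infinite_setN0 Kinf.
have [i _ iinj'] := card_le_inj k0 ((infiniteP _).1 Kinf).
have iinj m n : i m = i n -> m = n by exact: iinj'.
have /choice[j jP] : forall k, exists n, range i k -> k = i n.
  by move=> k; have [[n _ <-]|nk] := pselect (range i k); [exists n|exists 0%N].
pose g0 a b := i (pickle (j a, j b)).
have g0P : square_inj (range i) g0.
  split=> [a b _ _|a b a' b' /jP aE /jP bE /jP aE' /jP bE']; first by eexists.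
  by move=> /iinj /(pcan_inj pickleK) [E E']; rewrite aE bE E E'.
(* Starting from [range i] makes the maximal domain infinite. *)
have [G [G0G Gsq Gmax]] := Zorn_above (square_graph_on g0P)
  (fun F _ FP => square_graph_chain FP).
have [g gP GE] := square_graphE Gsq; set A := dom G in gP GE.
have iA n : A (i n).
  have : dom (graph_on (range i) g0) (i n) by rewrite dom_graph_on; exists n.
  by move=> [c /G0G Gc]; exists c.
have [gA ginj] := gP.
have [/(card_le_inj k0) [h hA hinj]|] := card_le_total_same A (~` A).
  have [|g' g'P g'E] := square_inj_extend (tag := fun x y => i (x + y.*2)%N)
      gP hA hinj (fun _ _ => iA _).
    by move=> [] [] [] [] /iinj.
  have sub : graph_on (A `|` h @` A) g' `<=` G.
    apply: Gmax (square_graph_on g'P); rewrite GE => -[[a b] c] [/= Aa Ab ->].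
    by split=> /=; [left|left|rewrite g'E].
  have Ai := iA 0%N; case: (hA _ Ai).
  exists (g' (h (i 0%N)) (h (i 0%N))); apply: sub.
  by split=> //=; right; exists (i 0%N).
move=> /(card_le_inj k0)[m mA minj].
pose q u := if u \in A then g (i 0%N) u else g (i 1%N) (m u).
have mP u : u \notin A -> A (m u) by rewrite notin_setE; exact: mA.
have qA u : A (q u).
  rewrite /q; case: ifPn => [/set_mem Au|/mP Au]; exact: gA.
have qinj u v : q u = q v -> u = v.
  rewrite /q; case: ifPn => [/set_mem Au|uA]; case: ifPn => [/set_mem Av|vA].
  - by move=> /ginj[].
  - by move=> /ginj[] //; [exact: mP|move=> /iinj].
  - by move=> /ginj[] //; [exact: mP|move=> /iinj].
  - move=> /ginj[] //; [exact: mP|exact: mP|move=> _].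
    by apply: minj; rewrite /setC /= -notin_setE.
exists (fun u v => g (q u) (q v)) => a b c d.
by move=> /ginj[] // /qinj -> /qinj ->.
Qed.
End Squares.

(** * Compactness and locally finite points *)

Lemma compact_directed_bigcap (X : topologicalType) (I : Type) (P : set I)
    (F : I -> set X) :
  compact [set: X] -> P !=set0 ->
  (forall i, P i -> closed (F i)) -> (forall i, P i -> F i !=set0) ->
  (forall i j, P i -> P j -> exists2 k, P k & F k `<=` F i `&` F j) ->
  exists x, forall i, P i -> F i x.
Proof.
move=> Xc P0 Fcl F0 Fdir.
have FF := filter_from_filter P0 Fdir.
have [x [_ clx]] := Xc _ (filter_from_proper FF F0) (@filterT _ _ FF).
exists x => i Pi; apply: (Fcl _ Pi) => B Bx.
by apply: clx => //; exists i.
Qed.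

Definition locally_finite (X : topologicalType) (D : set X) : set X :=
  [set x | exists U, [/\ open U, U x & finite_set (U `&` D)]].

Lemma open_locally_finite (X : topologicalType) (D : set X) :
  open (locally_finite D).
Proof.
rewrite openE => x [U [oU Ux Ufin]].
by apply: filterS (open_nbhs_nbhs (conj oU Ux)) => y Uy; exists U.
Qed.

Lemma discrete_isolating_nbhs (X : topologicalType) (D : set X) (x : X) :
  discrete_set D -> D x -> exists U, [/\ open U, U x & U `&` D `<=` [set x]].
Proof.
move=> /discrete_setP /[apply] -[_ [V Vx VD]].
move: Vx; rewrite nbhsE => -[U [oU Ux] UV].
by exists U; split=> //; rewrite -VD; exact: setSI.
Qed.

Lemma discrete_sub_locally_finite (X : topologicalType) (D : set X) :
  discrete_set D -> D `<=` locally_finite D.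
Proof.
move=> /discrete_isolating_nbhs dD x /dD [U [oU Ux UD]].
by exists U; split=> //; exact: sub_finite_set UD (finite_set1 x).
Qed.

(** The open sets [U] with [U `&` D] finite are closed under finite unions and
    cover [F], so one of them contains [F]. *)
Lemma compact_locally_finite_trace (X : topologicalType) (D F : set X) :
  compact [set: X] -> closed F -> F `<=` locally_finite D ->
  finite_set (F `&` D).
Proof.
move=> Xc Fcl FD; pose P := [set U : set X | open U /\ finite_set (U `&` D)].
have [[U [oU Ufin] FU]|nFU] := pselect (exists2 U, P U & F `<=` U).
  by apply: sub_finite_set Ufin; exact: setSI.
have [||||x xP] := @compact_directed_bigcap X _ P (fun U => F `\` U) Xc.
- by exists set0; split; [exact: open0|rewrite set0I; exact: finite_set0].
- by move=> U [oU _]; apply: closedI => //; exact: open_closedC.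
- move=> U PU; apply: contrapT => FU0; apply: nFU; exists U => // x Fx.
  by apply: contrapT => nUx; apply: FU0; exists x; split.
- move=> U V [oU Ufin] [oV Vfin]; exists (U `|` V).
    by split; [exact: openU|rewrite setIUl finite_setU].
  by move=> x [Fx nUVx]; split; split=> // Vx; apply: nUVx; [left|right].
have [Fx _] : (F `\` set0) x.
  by apply: xP; split; [exact: open0|rewrite set0I; exact: finite_set0].
have [U [oU Ux Ufin]] := FD x Fx.
by have [_ []] := xP U (conj oU Ufin).
Qed.

(** * A compactum whose points have small pseudocharacter *)

Section Terms.
Variables (X : topologicalType) (K J : Type).
Variables (D : K -> set X) (U : X -> J -> set X) (listing : set X -> nat -> X).

(** Terms name the closed sets of the closing-off process, [region] being the
    set named.  The points that arise on the way are the
    [listing (region s `&` D k) n], where [listing A] runs through [A] when [A]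
    is finite and is arbitrary otherwise. *)
Inductive term :=
| whole
| accum of K
| cap of term & term
| avoid of term & K & nat & J.

Fixpoint region (t : term) : set X :=
  match t with
  | whole => setT
  | accum k => ~` locally_finite (D k)
  | cap s t => region s `&` region t
  | avoid s k n l => ~` U (listing (region s `&` D k) n) l
  end.

Lemma closed_region t : (forall x j, open (U x j)) -> closed (region t).
Proof.
move=> oU; elim: t => [|k|s cs t ct|s _ k n l] /=.
- exact: closedT.
- exact/open_closedC/open_locally_finite.
- exact: closedI.
- exact/open_closedC/oU.
Qed.

(** Suppose [x] does not arise.  All regions containing [x] are intersected with
    a maximal family [S] of sets [region (accum k)]; a point [y] of the
    intersection is then shown to arise, so that a region contains [x] and
    avoids [y]. *)
Lemma point_named_by_term :
  compact [set: X] -> (forall k, discrete_set (D k)) ->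
  (forall x, exists k, D k x) ->
  (forall x j, open (U x j)) -> (forall x y, (forall j, U x j y) <-> y = x) ->
  (forall A a, finite_set A -> A a -> exists n, listing A n = a) ->
  forall x, exists t k n, x = listing (region t `&` D k) n.
Proof.
move=> Xc dD Dcov oU U1 listingP x; apply: contrapT => xN.
pose H (S : set K) : set X :=
  [set y | (forall t, region t x -> region t y) /\
           forall k, S k -> region (accum k) y].
have Hcl S : closed (H S).
  have -> : H S = (\bigcap_(t in [set t | region t x]) region t) `&`
                  \bigcap_(k in S) region (accum k) by [].
  by apply: closedI; apply: closed_bigI => i _; exact: closed_region.
have HS S S' : S `<=` S' -> H S' `<=` H S.
  by move=> SS' y [yx yS']; split=> // k /SS' /yS'.
have [S [_ [y yH] Smax]] :
    exists S, [/\ set0 `<=` S, H S !=set0 &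
      forall S', S `<=` S' -> H S' !=set0 -> S' `<=` S].
  apply: (@Zorn_above _ [set S | H S !=set0]).
    by exists x; split.
  move=> F F0 FP Ftot.
  have [|y yP] := compact_directed_bigcap Xc F0 (fun S _ => Hcl S) FP.
    move=> S S' FS FS'; have [SS'|S'S] := Ftot _ _ FS FS'.
      by exists S' => // y yS'; split=> //; exact: HS yS'.
    by exists S => // y yS; split=> //; exact: HS yS.
  exists y; split=> [|k [S FS Sk]]; last by have [_] := yP S FS; apply.
  by have [S FS] := F0; have [] := yP S FS.
have [k Dky] := Dcov y.
have kS : ~ S k.
  by move=> Sk; apply: (yH.2 k Sk); exact: discrete_sub_locally_finite.
(* The regions containing [H S] form a directed family with intersection
   [H S], which misses [region (accum k)] because [S] is maximal. *)
have [t Ht tk] : exists2 t, H S `<=` region t &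
    region t `<=` locally_finite (D k).
  apply: contrapT => nt.
  have [||||z zP] := @compact_directed_bigcap X _
      [set t | H S `<=` region t] (fun t => region (cap t (accum k))) Xc.
  - by exists whole.
  - by move=> t _; exact: closed_region.
  - move=> t Ht; apply: contrapT => tk0; apply: nt; exists t => // z tz.
    by apply: contrapT => zk; apply: tk0; exists z.
  - move=> s t Hs Ht; exists (cap s t).
      by move=> z Hz; split; [exact: Hs|exact: Ht].
    by move=> z [[sz tz] kz].
  apply: kS; apply: (Smax (S `|` [set k])); [by left| |by right].
  exists z; split=> [t tx|l [Sl|->]].
  - by have [|] := zP t; first by move=> w [/(_ t tx)].
  - by have [|] := zP (accum l); first by move=> w [_ /(_ l Sl)].
  - by have [|] := zP whole.
have [n ny] : exists n, listing (region t `&` D k) n = y.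
  apply: listingP; last by split=> //; exact: Ht.
  by apply: compact_locally_finite_trace => //; exact: closed_region.
(* [y] arises and [x] does not, so [y] and [x] differ. *)
have [l nUl] : exists l, ~ U y l x.
  apply: contrapT => nl; apply: xN; exists t, k, n; rewrite ny.
  by apply/U1 => l; apply: contrapT => nUl; apply: nl; exists l.
have := yH.1 (avoid t k n l); rewrite /= ny => /(_ nUl); apply.
exact: ((U1 y y).2 erefl).
Qed.

(** With a pairing function, finite trees labelled in an infinite [K] are coded
    in [K] itself, four elements of [K] serving as tags of the constructors. *)
Lemma term_embedding (p : K -> K -> K) (i : nat -> K) (q : J -> K) :
  (forall a b c d, p a b = p c d -> a = c /\ b = d) ->
  injective i -> injective q ->
  exists f : term -> K, injective f.
Proof.
move=> pinj iinj qinj.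
pose f := fix f t := match t with
  | whole => p (i 0%N) (i 0%N)
  | accum k => p (i 1%N) k
  | cap s t => p (i 2%N) (p (f s) (f t))
  | avoid s k n l => p (i 3%N) (p (p (f s) k) (p (i n) (q l)))
  end.
exists f; elim=> [|k|s IHs t IHt|s IHs k n l] [|k'|s' t'|s' k' n' l'] //=;
  move=> /pinj[/iinj // _].
- by move=> ->.
- by move=> /pinj[/IHs -> /IHt ->].
- by move=> /pinj[/pinj[/IHs -> ->] /pinj[/iinj -> /qinj ->]].
Qed.
End Terms.

Lemma listing_finite_sets (X : Type) (x0 : X) :
  exists listing : set X -> nat -> X,
    forall A a, finite_set A -> A a -> exists n, listing A n = a.
Proof.
suff /choice[listing listingP] : forall A : set X, exists e : nat -> X,
    forall a, finite_set A -> A a -> exists n, e n = a by exists listing.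
move=> A; have [Afin|nA] := pselect (finite_set A); last by exists (fun=> x0).
have /pfcard_geP[->|/surjfunPex[f AE]] := finite_set_countable Afin.
  by exists (fun=> x0).
by exists f => a _; rewrite AE => -[n _ <-]; exists n.
Qed.

Lemma card_le_discrete_cover (X : topologicalType) (K : Type)
    (D : K -> set X) (U : X -> K * nat -> set X) :
  infinite_set [set: K] ->
  compact [set: X] -> (forall k, discrete_set (D k)) ->
  (forall x, exists k, D k x) ->
  (forall x j, open (U x j)) -> (forall x y, (forall j, U x j y) <-> y = x) ->
  [set: X] #<= [set: K].
Proof.
move=> Kinf Xc dD Dcov oU U1.
have [[x0]|nX] := pselect (inhabited X); last first.
  have -> : [set: X] = set0 by apply/seteqP; split=> // x _; case: nX.
  exact: card_ge0.
have [k0 _] := infinite_setN0 Kinf.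
have [p pinj] := infinite_pairing Kinf.
have [i _ iinj'] := card_le_inj k0 ((infiniteP _).1 Kinf).
have iinj : injective i by move=> m n; exact: iinj'.
have qinj : injective (fun l : K * nat => p l.1 (i l.2)).
  by move=> [a m] [b n] /pinj[/= -> /iinj ->].
have [listing listingP] := listing_finite_sets x0.
have [f finj] := term_embedding pinj iinj qinj.
have /choice[t /choice[k /choice[n nP]]] :=
  point_named_by_term Xc dD Dcov oU U1 listingP.
apply: (@inj_le_card _ _ _ _ (fun x => p (f (t x)) (p (k x) (i (n x))))) => //.
move=> x y _ _ /pinj[/finj tE /pinj[kE /iinj nE]].
by rewrite (nP x) (nP y) tE kE nE.
Qed.

(** * Discrete sets are nowhere dense *)

Lemma hausdorff_closed1 (X : topologicalType) (x : X) :
  hausdorff_space X -> closed [set x].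
Proof. by move=> hX; exact/accessible_closed_set1/hausdorff_accessible. Qed.

(** An isolating neighbourhood [U] of a point [x] of [D] meets [H] in a further
    point, because [x] is not isolated in [H]; hence [U] minus [x] works. *)
Lemma avoid_discrete (X : topologicalType) (H D : set X) :
  hausdorff_space X -> discrete_set D -> H !=set0 ->
  (forall G x, open G -> H `&` G <> [set x]) ->
  exists G, [/\ open G, H `&` G !=set0 & H `&` G `&` D = set0].
Proof.
move=> hX dD [h Hh] Hcrowded.
have [[x Hx Dx]|HD] := pselect (exists2 x, H x & D x); last first.
  exists setT; split; [exact: openT|by exists h|].
  by apply/seteqP; split=> // x [[Hx _] Dx]; case: HD; exists x.
have [U [oU Ux UD]] := discrete_isolating_nbhs dD Dx.
exists (U `\` [set x]); split.
- by rewrite setDE; apply: openI => //; exact/closed_openC/hausdorff_closed1.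
- apply: contrapT => HUx; apply: (Hcrowded U x oU).
  apply/seteqP; split=> [y [Hy Uy]|_ ->] //.
  by apply: contrapT => nyx; apply: HUx; exists y.
- by apply/seteqP; split=> // y [[_ [Uy nyx]] Dy]; apply: nyx; exact: UD.
Qed.

(** Without isolated points, the members of [C] could be avoided one by one by
    smaller and smaller nonempty open sets. *)
Lemma finite_discrete_cover_isolated (X : topologicalType) (C : set (set X)) :
  hausdorff_space X -> [set: X] !=set0 -> discrete_cover C -> finite_set C ->
  exists x : X, open [set x].
Proof.
move=> hX [x0 _] [dC covC] /finite_seqP [s Cs].
apply: contrapT => noiso.
have [G [oG [x Gx] OC]] : exists G : set X, [/\ open G, G !=set0 &
    forall D, D \in s -> G `&` D = set0].
  have : forall D, D \in s -> discrete_set D by move=> D Ds; apply: dC; rewrite Cs.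
  elim: s {C Cs dC covC} => [|D s IH] ds.
    by exists setT; split; [exact: openT|exists x0|].
  have [D' D's|G [oG O0 Os]] := IH; first by apply: ds; rewrite inE D's orbT.
  have [||G' [oG' OO'0 OO'D]] := @avoid_discrete X G D hX _ O0.
  - by apply: ds; rewrite mem_head.
  - move=> V x oV OV; apply: noiso; exists x; rewrite -OV; exact: openI.
  exists (G `&` G'); split=> //; first exact: openI.
  move=> D'; rewrite inE => /orP[/eqP ->//|/Os OD'].
  by rewrite setIAC OD' set0I.
have : (\bigcup_(D in C) D) x by rewrite covC.
move=> [D CD Dx]; have : (G `&` D) x by [].
by rewrite OC //; move: CD; rewrite Cs.
Qed.

(** The point of the inclusions [closure (V n.+1) `<=` V n] is that the
    intersection of the [V n] is at once closed, as compactness arguments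
    require, and an intersection of countably many open sets. *)
Lemma regular_shrinking (X : topologicalType) (G : set X) (x : X) :
  compact [set: X] -> hausdorff_space X -> open G -> G x ->
  exists V : nat -> set X, [/\ forall n, open (V n), forall n, V n x,
    forall n, closure (V n.+1) `<=` V n & V 0%N = G].
Proof.
move=> Xc hX oG Gx.
have /choice[r rP] : forall W : set X, exists V, open W -> W x ->
    [/\ open V, V x & closure V `<=` W].
  move=> W; have [[oW Wx]|nW] := pselect (open W /\ W x); last first.
    by exists W => oW Wx; case: nW.
  have [V Vx VW] := compact_regular hX Xc (@filterT _ (nbhs x) _)
    (open_nbhs_nbhs (conj oW Wx)).
  move: Vx; rewrite nbhsE => -[V' [oV' V'x] V'V].
  by exists V' => _ _; split=> //; apply: subset_trans VW; exact: closureS.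
pose V n := iter n r G.
have VP n : open (V n) /\ V n x.
  by elim: n => [//|n [oV Vx]] /=; have [] := rP _ oV Vx.
exists V; split=> // n; [exact: (VP n).1|exact: (VP n).2|].
by have [oV Vx] := VP n; have [] := rP _ oV Vx.
Qed.

(** Consider the sets [S] that assign to some indices [k] a shrinking sequence
    [V] of open sets, such that the intersection [H S] of all the assigned
    sequences is nonempty and misses [D k] for these [k].  By compactness there
    is a maximal such [S].  Its [H S] cannot miss all the [D k]; if [H S] had no
    isolated points, it could be shrunk further to miss one more [D k].  Hence
    [H S] has an isolated point [x], and [x] is the intersection of the open
    sets assigned by [S] and of one further open set. *)
Lemma discrete_cover_pseudopoint (X : topologicalType) (K : Type)
    (D : K -> set X) :
  compact [set: X] -> hausdorff_space X -> [set: X] !=set0 ->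
  (forall k, discrete_set (D k)) -> (forall x, exists k, D k x) ->
  exists x (W : K * nat -> set X), (forall j, open (W j)) /\
    forall y, (forall j, W j y) <-> y = x.
Proof.
move=> Xc hX [x0 _] dD Dcov.
pose H (S : set (K * (nat -> set X))) : set X :=
  [set y | forall k V, S (k, V) -> forall n, V n y].
pose P S := [/\
  forall k V, S (k, V) ->
    (forall n, open (V n)) /\ (forall n, closure (V n.+1) `<=` V n),
  forall k V V', S (k, V) -> S (k, V') -> V = V',
  forall k V, S (k, V) -> H S `&` D k = set0 &
  H S !=set0].
have HS S S' : S `<=` S' -> H S' `<=` H S.
  by move=> SS' y yS' k V /SS' /yS'.
have Hcl S : P S -> closed (H S).
  move=> [SV _ _ _] y cly k V SkV n; apply: (SV _ _ SkV).2.
  by apply: closureS cly => z /(_ k V SkV).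
have [S [_ PS Smax]] : exists S, [/\ set0 `<=` S, P S &
    forall S', S `<=` S' -> P S' -> S' `<=` S].
  apply: Zorn_above => [|F F0 FP Ftot].
    by split=> //; exists x0.
  have sub S : F S -> S `<=` \bigcup_(S in F) S by move=> FS s Ss; exists S.
  split.
  - by move=> k V [S FS SkV]; have [SV _ _ _] := FP _ FS; exact: SV SkV.
  - move=> k V V' [S FS SkV] [S' FS' SkV'].
    have [SS'|S'S] := Ftot _ _ FS FS'.
      by have [_ Sf _ _] := FP _ FS'; apply: Sf SkV' => //; exact: SS'.
    by have [_ Sf _ _] := FP _ FS; apply: Sf SkV _; exact: S'S.
  - move=> k V [S FS SkV]; have [_ _ SD _] := FP _ FS.
    apply/seteqP; split=> // y [Hy Dy]; rewrite -(SD k V SkV).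
    by split=> //; apply: HS Hy; exact: sub.
  have [| |S S' FS FS'|y yP] := @compact_directed_bigcap X _ F H Xc F0.
  - by move=> S /FP /Hcl.
  - by move=> S /FP[].
  - have [SS'|S'S] := Ftot _ _ FS FS'.
      by exists S' => // y yS'; split=> //; exact: HS yS'.
    by exists S => // y yS; split=> //; exact: HS yS.
  by exists y => k V [S FS SkV]; exact: yP SkV.
have [SV Sf SD [h Hh]] := PS.
have [k Dkh] := Dcov h.
have kS V : ~ S (k, V).
  by move=> /SD HD; have : (H S `&` D k) h by []; rewrite HD.
have [G [x [oG HO]]] : exists G x, open G /\ H S `&` G = [set x].
  apply: contrapT => noiso.
  have [||G [oG [y [Hy Oy]] OD]] := @avoid_discrete X (H S) (D k) hX (dD k).
  - by exists h.
  - by move=> G x oG HO; apply: noiso; exists G, x.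
  have [V [oV Vy clV V0]] := regular_shrinking Xc hX oG Oy.
  apply: (kS V); apply: (Smax (S `|` [set (k, V)])); [by left| |by right].
  split.
  - by move=> l W [/SV//|[_ ->]].
  - move=> l W W' [SlW|[lk WV]] [SlW'|[lk' WV']].
    + exact: Sf SlW SlW'.
    + by case: (kS W); rewrite -lk'.
    + by case: (kS W'); rewrite -lk.
    + by rewrite WV WV'.
  - move=> l W SlW; apply/seteqP; split=> // z [Hz Dz].
    have Hz' : H S z by apply: HS Hz; left.
    case: SlW => [/SD HD|[lk _]].
      by have : (H S `&` D l) z by []; rewrite HD.
    have : (H S `&` G `&` D k) z; last by rewrite OD.
    split; last by rewrite -lk.
    by split=> //; rewrite -V0; apply: (Hz k); right.
  - by exists y => l W [/Hy//|[_ ->]].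
(* For [j = (l, n)] the first factor is [V n] if [S] assigns [V] to [l], and
   [setT] if [S] assigns nothing to [l]. *)
exists x, (fun j => [set y | forall V, S (j.1, V) -> V j.2 y] `&` G).
split=> [[l n]|y] /=.
  apply: openI => //.
  have [[V SlV]|nV] := pselect (exists V, S (l, V)).
    have -> : [set y | forall V, S (l, V) -> V n y] = V n.
      apply/seteqP; split=> [y|y Vy W SlW]; first by move=> /(_ V SlV).
      by rewrite (Sf _ _ _ SlW SlV).
    exact: (SV _ _ SlV).1.
  have -> : [set y | forall V, S (l, V) -> V n y] = setT; last exact: openT.
  by apply/seteqP; split=> // y _ V SlV; case: nV; exists V.
have HOx z : (H S `&` G) z <-> z = x by rewrite HO.
split=> [yW|->].
  apply/HOx; split; last by have [] := yW (k, 0%N).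
  by move=> l V SlV n; have [/(_ V SlV)] := yW (l, n).
have [Hx Gx] := (HOx x).2 erefl.
by move=> [l n]; split=> // V /Hx.
Qed.

(** * Transfer by homogeneity, and the theorem *)

Lemma homogeneous_pseudobase (X : topologicalType) (J : Type) (x : X)
    (W : J -> set X) :
  homogeneous X -> (forall j, open (W j)) ->
  (forall y, (forall j, W j y) <-> y = x) ->
  exists U : X -> J -> set X, (forall y j, open (U y j)) /\
    forall y z, (forall j, U y j z) <-> z = y.
Proof.
move=> homX oW Wx.
suff /choice[U UP] : forall y, exists V : J -> set X, (forall j, open (V j)) /\
    forall z, (forall j, V j z) <-> z = y.
  by exists U; split=> y; [exact: (UP y).1|exact: (UP y).2].
move=> y; have [f [[cf [g [cg fK gK]]] fxy]] := homX x y.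
exists (fun j => g @^-1` W j); split=> [j|z].
  by apply: open_comp => // z _; exact: cg.
split=> [/Wx gzx|-> j]; first by rewrite -fxy -gzx gK.
by rewrite /= -fxy fK; exact: (Wx x).2 erefl j.
Qed.

Unset Implicit Arguments.

Theorem theorem2p23 (X : topologicalType) :
  compact [set: X] -> hausdorff_space X -> homogeneous X ->
  dis X #>= Delta X.
Proof.
move=> Xc hX homX.
have [X0|nX] := pselect ([set: X] !=set0); last first.
  have -> : Delta X = set0 by apply/seteqP; split=> // x _; case: nX; exists x.
  exact: card_ge0.
have [oDelta Delta0 DeltaMin] := DeltaP X0.
have [[dC covC] _] := disP X; set C := dis X in dC covC *.
have [Cfin|Cinf] := pselect (finite_set C).
  have [x ox] := finite_discrete_cover_isolated hX X0 (conj dC covC) Cfin.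
  apply: card_le_trans (DeltaMin _ ox _) _; first by exists x.
  have : (\bigcup_(D in C) D) x by rewrite covC.
  move=> [D CD _].
  by apply: (@inj_le_card _ _ _ _ (fun=> D)) => // y z -> ->.
pose K := set_type C; pose D (k : K) : set X := set_val k.
have Kinf : infinite_set [set: K].
  by move=> Kfin; apply: Cinf; rewrite -(eq_finite_set (card_setT C)).
have dD k : discrete_set (D k) by apply: dC; exact: set_valP.
have Dcov x : exists k, D k x.
  have : (\bigcup_(D in C) D) x by rewrite covC.
  by move=> [A CA Ax]; exists (SigSub (mem_set CA)).
have [x [W [oW Wx]]] := discrete_cover_pseudopoint Xc hX X0 dD Dcov.
have [U [oU Ux]] := homogeneous_pseudobase homX oW Wx.
apply: card_le_trans (card_leT _) _.
apply: card_le_trans (card_le_discrete_cover Kinf Xc dD Dcov oU Ux) _.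
by rewrite (card_le_eql (card_setT C)).
Qed.
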